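(* Let $A\in\mathbb{R}^{n_x\times n_x}$ be invertible, $B\in\mathbb{R}^{n_x\times n_u}$, with $(A,B)$ controllable, and let $H=\begin{bmatrix}Q&S^\top\\ S&R\end{bmatrix}$ be real symmetric. Assume quadratic strict pre-dissipativity: there is a symmetric $\Lambda$ with $H_\Lambda\succeq0$ and $Q_\Lambda-S_\Lambda^\top R_\Lambda^\dagger S_\Lambda\succ0$. Let $\bar P_{\mathrm s}$ be the stabilizing solution of the RCGDARE, and let the symmetric terminal cost matrix satisfy $P^{\mathrm f}\succ\bar P_{\mathrm s}$. Then the optimal solution of the infinite-horizon problem $$V(\hat x_0)=\min_{x,u}\ \lim_{N\to\infty}\sum_{k=0}^{N-1}\begin{bmatrix}x_k\\ u_k\end{bmatrix}^\top H\begin{bmatrix}x_k\\ u_k\end{bmatrix}+x_N^\top P^{\mathrm f}x_N\quad\text{s.t. } x_0=\hat x_0,\ x_{k+1}=Ax_k+Bu_k$$ is given by the unique stabilizing solution $P_{\mathrm s}$ (with feedback $K_{\mathrm s}$) of the rDARE, i.e. $V(x)=x^\top P_{\mathrm s}x$ and the optimal feedback law is $u=-K_{\mathrm s}x+Gv$, $v$ arbitrary. In particular, the origin is an asymptotically stable equilibrium of the optimally controlled system.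
   Context: For symmetric $M\in\mathbb{R}^{n_x\times n_x}$ define $Q_M:=Q+A^\top MA-M$, $S_M:=S+B^\top MA$, $R_M:=R+B^\top MB$, $H_M:=\begin{bmatrix}Q_M&S_M^\top\\ S_M&R_M\end{bmatrix}$. $\dagger$ denotes the Moore-Penrose pseudo-inverse. CGDARE (symmetric unknown $P$): $0=Q_P-S_P^\top K$, $K=R_P^\dagger S_P$, $\ker(R_P)\subseteq\ker(S_P^\top)$. Matrix $G:=I-R_P^\dagger R_P$, where $P$ is a symmetric solution of the CGDARE ($G$ does not depend on which solution is used). rDARE (regularized DARE, symmetric unknown $P$ with $R_P+G$ invertible): $0=Q_P-S_P^\top K$, $K=(R_P+G)^{-1}S_P$. A solution is stabilizing if all eigenvalues of $A-BK$ lie strictly inside the unit circle. RCGDARE (reverse CGDARE, symmetric unknown $\bar P$): $\bar P=\bar Q+\bar A^\top\bar P\bar A-(\bar S^\top+\bar A^\top\bar P\bar B)\bar K$, $\bar K=(\bar R+\bar B^\top\bar P\bar B)^\dagger(\bar S+\bar B^\top\bar P\bar A)$, $\ker(\bar R+\bar B^\top\bar P\bar B)\subseteq\ker(\bar S^\top+\bar A^\top\bar P\bar B)$, where $\bar A:=A^{-1}$, $\bar B:=A^{-1}B$, $\bar Q:=-\bar A^\top Q\bar A$, $\bar S:=S\bar A-\bar B^\top Q\bar A$, $\bar R:=-R+S\bar B+\bar B^\top S^\top-\bar B^\top Q\bar B$. Its stabilizing solution $\bar P_{\mathrm s}$ is the symmetric solution for which all eigenvalues of $\bar A-\bar B\bar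 K$ lie strictly inside the unit circle. *)

(* Defs.v *)
From mathcomp Require Import all_boot all_order all_algebra.
From mathcomp Require Import complex.
From mathcomp Require Import all_classical all_reals ereal topology normedtype.

Set Implicit Arguments.
Unset Strict Implicit.
Unset Printing Implicit Defensive.

Import Order.TTheory GRing.Theory Num.Theory.
Import numFieldNormedType.Exports.

Local Open Scope classical_set_scope.
Local Open Scope ring_scope.

Definition symmetric_mx (F : realType) n (M : 'M[F]_n) : Prop := M^T = M.

Definition qform (F : realType) n (M : 'M[F]_n) (x : 'cV[F]_n) : F :=
  (x^T *m M *m x) 0 0.

Definition possemidef (F : realType) n (M : 'M[F]_n) : Prop :=
  symmetric_mx M /\ forall x, 0 <= qform M x.

Definition posdef (F : realType) n (M : 'M[F]_n) : Prop :=
  symmetric_mx M /\ forall x, x != 0 -> 0 < qform M x.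

Definition schur_stable (F : realType) n (M : 'M[F]_n) : Prop :=
  forall z : F[i], eigenvalue (map_mx (real_complex F) M) z -> `|z| < 1.

Definition ker_sub (F : realType) m p n (M : 'M[F]_(m, n)) (N : 'M[F]_(p, n))
  : Prop :=
  forall v : 'cV[F]_n, M *m v = 0 -> N *m v = 0.

Section MoorePenrose.
Variable F : realType.

Definition penrose m n (M : 'M[F]_(m, n)) (X : 'M[F]_(n, m)) : Prop :=
  [/\ M *m X *m M = M, X *m M *m X = X,
      (M *m X)^T = M *m X & (X *m M)^T = X *m M].

(* The choice is immaterial: see pinvP and penrose_uniq. *)
Definition pinv m n (M : 'M[F]_(m, n)) : 'M[F]_(n, m) :=
  xget 0 [set X | penrose M X].

Lemma penrose_uniq m n (M : 'M[F]_(m, n)) X Y :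
  penrose M X -> penrose M Y -> X = Y.
Proof.
move=> [X1 X2 X3 X4] [Y1 Y2 Y3 Y4].
have MXY : M *m X = M *m Y.
  by rewrite -X3 -{1}Y1 -[_ *m X]mulmxA trmx_mul X3 Y3 mulmxA X1.
have XMY : X *m M = Y *m M.
  by rewrite -X4 -{1}Y1 -mulmxA mulmxA trmx_mul X4 Y4 -mulmxA (mulmxA M) X1.
by rewrite -X2 XMY -mulmxA MXY mulmxA Y2.
Qed.

Lemma gram_unit m n (M : 'M[F]_(m, n)) : row_free M -> M *m M^T \in unitmx.
Proof.
move=> fM; rewrite -row_free_unit; apply: inj_row_free => v v0.
apply: (row_free_inj fM); rewrite mul0mx; apply/rowP => j.
have /matrixP/(_ 0 0) : (v *m M) *m (v *m M)^T = 0.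
  by rewrite trmx_mul !mulmxA -(mulmxA v) v0 mul0mx.
rewrite mxE [RHS]mxE.
under eq_bigr do rewrite [X in _ * X]mxE -expr2.
by move/psumr_eq0P => /(_ (fun i _ => sqr_ge0 _) j isT)/eqP;
  rewrite sqrf_eq0 [RHS]mxE => /eqP.
Qed.

Lemma pinvP m n (M : 'M[F]_(m, n)) : penrose M (pinv M).
Proof.
apply: (@xgetPex _ 0 [set X | penrose M X]).
have := mulmx_base M; have := row_base_free M; have := col_base_full M.
move: (row_base M) (col_base M); move: (\rank M) => r D C fC fD MCD.
have uD : D *m D^T \in unitmx by apply/gram_unit.
have uC : C^T *m C \in unitmx.
  rewrite -{2}[C]trmxK; apply/gram_unit.
  by rewrite /row_free mxrank_tr.
have sD : (invmx (D *m D^T))^T = invmx (D *m D^T).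
  by rewrite trmx_inv trmx_mul trmxK.
have sC : (invmx (C^T *m C))^T = invmx (C^T *m C).
  by rewrite trmx_inv trmx_mul trmxK.
pose X := D^T *m invmx (D *m D^T) *m invmx (C^T *m C) *m C^T.
have MX : M *m X = C *m invmx (C^T *m C) *m C^T.
  by rewrite /X -MCD !mulmxA -(mulmxA C D) mulmxK.
have XM : X *m M = D^T *m invmx (D *m D^T) *m D.
  by rewrite /X -MCD mulmxA -(mulmxA _ C^T C) mulmxKV.
exists X; split.
- by rewrite MX -MCD mulmxA -(mulmxA _ C^T C) mulmxKV.
- rewrite XM /X !mulmxA; congr (_ *m _ *m _).
  by rewrite -(mulmxA _ D D^T) mulmxKV.
- by rewrite MX !trmx_mul trmxK sC mulmxA.
- by rewrite XM !trmx_mul trmxK sD mulmxA.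
Qed.

End MoorePenrose.

Section Riccati.
Variables (F : realType) (nx nu : nat).
Variables (A : 'M[F]_nx) (B : 'M[F]_(nx, nu)).
Variables (Q : 'M[F]_nx) (S : 'M[F]_(nu, nx)) (R : 'M[F]_nu).

Definition cost_mx : 'M[F]_(nx + nu) := block_mx Q S^T S R.

Definition QM (M : 'M[F]_nx) : 'M[F]_nx := Q + A^T *m M *m A - M.
Definition SM (M : 'M[F]_nx) : 'M[F]_(nu, nx) := S + B^T *m M *m A.
Definition RM (M : 'M[F]_nx) : 'M[F]_nu := R + B^T *m M *m B.
Definition HM (M : 'M[F]_nx) : 'M[F]_(nx + nu) :=
  block_mx (QM M) (SM M)^T (SM M) (RM M).

Definition strictly_predissipative : Prop :=
  exists L : 'M[F]_nx, [/\ symmetric_mx L, possemidef (HM L)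
    & posdef (QM L - (SM L)^T *m pinv (RM L) *m SM L)].

Definition cgdare_gain (P : 'M[F]_nx) : 'M[F]_(nu, nx) :=
  pinv (RM P) *m SM P.

Definition cgdare (P : 'M[F]_nx) : Prop :=
  [/\ symmetric_mx P, 0 = QM P - (SM P)^T *m cgdare_gain P
    & ker_sub (RM P) (SM P)^T].

Definition Gmx (P : 'M[F]_nx) : 'M[F]_nu := 1%:M - pinv (RM P) *m RM P.

Definition rdare_gain (G : 'M[F]_nu) (P : 'M[F]_nx) : 'M[F]_(nu, nx) :=
  invmx (RM P + G) *m SM P.

(* invmx is the identity outside unitmx, hence the invertibility clause. *)
Definition rdare (G : 'M[F]_nu) (P : 'M[F]_nx) : Prop :=
  [/\ symmetric_mx P, RM P + G \in unitmx
    & 0 = QM P - (SM P)^T *m rdare_gain G P].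

Definition rdare_stabilizing (G : 'M[F]_nu) (P : 'M[F]_nx) : Prop :=
  rdare G P /\ schur_stable (A - B *m rdare_gain G P).

Definition revA : 'M[F]_nx := invmx A.
Definition revB : 'M[F]_(nx, nu) := invmx A *m B.
Definition revQ : 'M[F]_nx := - (revA^T *m Q *m revA).
Definition revS : 'M[F]_(nu, nx) := S *m revA - revB^T *m Q *m revA.
Definition revR : 'M[F]_nu :=
  - R + S *m revB + revB^T *m S^T - revB^T *m Q *m revB.

End Riccati.

Section ReverseRiccati.
Variables (F : realType) (nx nu : nat).
Variables (A : 'M[F]_nx) (B : 'M[F]_(nx, nu)).
Variables (Q : 'M[F]_nx) (S : 'M[F]_(nu, nx)) (R : 'M[F]_nu).

Let Ab := revA A.
Let Bb := revB A B.
Let Qb := revQ A Q.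
Let Sb := revS A B Q S.
Let Rb := revR A B Q S R.

Definition rcgdare_gain (P : 'M[F]_nx) : 'M[F]_(nu, nx) :=
  pinv (Rb + Bb^T *m P *m Bb) *m (Sb + Bb^T *m P *m Ab).

Definition rcgdare (P : 'M[F]_nx) : Prop :=
  [/\ symmetric_mx P,
      P = Qb + Ab^T *m P *m Ab
            - (Sb^T + Ab^T *m P *m Bb) *m rcgdare_gain P
    & ker_sub (Rb + Bb^T *m P *m Bb) (Sb^T + Ab^T *m P *m Bb)].

Definition rcgdare_stabilizing (P : 'M[F]_nx) : Prop :=
  rcgdare P /\ schur_stable (Ab - Bb *m rcgdare_gain P).

End ReverseRiccati.

Section OptimalControl.
Variables (F : realType) (nx nu : nat).
Variables (A : 'M[F]_nx) (B : 'M[F]_(nx, nu)).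

Definition trajectory (x0 : 'cV[F]_nx) (x : nat -> 'cV[F]_nx)
    (u : nat -> 'cV[F]_nu) : Prop :=
  x 0%N = x0 /\ forall k, x k.+1 = A *m x k + B *m u k.

Definition controllable : Prop :=
  forall x0 x1 : 'cV[F]_nx, exists (N : nat) x u,
    trajectory x0 x u /\ x N = x1.

Variables (Q : 'M[F]_nx) (S : 'M[F]_(nu, nx)) (R : 'M[F]_nu).
Variable Pf : 'M[F]_nx.

Definition horizon_cost (x : nat -> 'cV[F]_nx) (u : nat -> 'cV[F]_nu)
    (N : nat) : F :=
  \sum_(0 <= k < N) qform (cost_mx Q S R) (col_mx (x k) (u k))
    + qform Pf (x N).

(* The limit is taken in the extended reals; a pair (x, u) whose horizon
   costs have no limit has no cost and is not a candidate in the problem. *)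
Definition feasible_cost (x0 : 'cV[F]_nx) (x : nat -> 'cV[F]_nx)
    (u : nat -> 'cV[F]_nu) (c : \bar F) : Prop :=
  trajectory x0 x u /\
  ((fun N => (horizon_cost x u N)%:E) @ \oo --> c).

Definition is_optimal_value (x0 : 'cV[F]_nx) (V : \bar F) : Prop :=
  (exists x u, feasible_cost x0 x u V) /\
  forall x u c, feasible_cost x0 x u c -> (V <= c)%E.

Definition is_optimal (x0 : 'cV[F]_nx) (x : nat -> 'cV[F]_nx)
    (u : nat -> 'cV[F]_nu) : Prop :=
  exists2 V, is_optimal_value x0 V & feasible_cost x0 x u V.

Definition optimally_controlled (x : nat -> 'cV[F]_nx) : Prop :=
  exists u, is_optimal (x 0%N) x u.

End OptimalControl.

(* T is the set of all state trajectories of a possibly set-valued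
   autonomous system. *)
Definition asymptotically_stable_origin (F : realType) n
    (T : set (nat -> 'cV[F]_n)) : Prop :=
  [/\ T (fun=> 0) /\ (forall x, T x -> x 0%N = 0 -> forall k, x k = 0),
      forall e : F, 0 < e -> exists2 d : F, 0 < d &
        forall x, T x -> `|x 0%N| < d -> forall k, `|x k| < e
    & exists2 d : F, 0 < d &
        forall x, T x -> `|x 0%N| < d -> x @ \oo --> (0 : 'cV[F]_n)].

(* Main.v *)
(* Along any trajectory the cost equals x_0' M x_0 plus the sum of the forms H_M
   plus x_N' (P^f - M) x_N, for every symmetric M. Value iteration from the
   storage matrix L increases and, by controllability, is bounded; its limit P_s
   has zero Riccati residual, and P_s - L is a Lyapunov function of the closed
   loop. For M = Pbar_s, reversing time shows H_M >= 0, so P^f > Pbar_s keeps the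
   state bounded on every run of bounded cost; for M = L this bounds the sum of
   H_L, which dominates a positive definite form of the state, so the state
   vanishes; for M = P_s the cost then is at least x_0' P_s x_0, with equality iff
   H_M vanishes along the run. *)
Require Import Defs.
From mathcomp Require Import all_boot all_order all_algebra.
From mathcomp Require Import complex ring lra.
From mathcomp Require Import all_classical all_reals ereal topology normedtype.
From mathcomp Require Import sequences.

Set Implicit Arguments.
Unset Strict Implicit.
Unset Printing Implicit Defensive.

Import Order.TTheory GRing.Theory Num.Theory.
Import numFieldNormedType.Exports.

Local Open Scope classical_set_scope.
Local Open Scope ring_scope.

(* mathcomp.classical's pinv, the inverse of a function, shadows the
   Moore-Penrose inverse. *)
Local Notation pinv := Defs.pinv.

(** Neither the stage cost nor $P^f$ has a sign, and $R$ may be singular; both facts shape the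
    proof. Because of the first, a run of finite cost is not known to converge, and the terminal
    form might reward large states. What bounds this reward is that every symmetric $M$ with
    $H_M\succeq0$ satisfies $\bar P_s\preceq M\preceq P_s$: along the closed loop of $P_s$ forward,
    and of $\bar P_s$ backward, the own form $H$ vanishes, so the difference to $M$ is monotone and
    tends to 0. Because of the second, the feedback is fixed only up to $\ker R_P$. For every CGDARE
    solution $P$ this kernel is $\ker B\cap\ker R$; hence $G$ is the orthogonal projector onto a
    space that does not involve $P$, its inputs neither move the state nor change the cost, and
    rDARE and CGDARE have the same solutions. Eigenvalues are complex while everything else is real.
    Cayley-Hamilton turns the spectral condition into geometric decay of powers, and a Lyapunov form
    evaluated at real and imaginary parts of an eigenvector gives the way back. *)

(** * Bilinear and quadratic forms, semidefinite blocks and the pseudo-inverse *)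

Section BilinearForms.
Variable F : realType.

Definition bform m n (M : 'M[F]_(m, n)) (x : 'cV_m) (y : 'cV_n) : F :=
  (x^T *m M *m y) 0 0.

Lemma qformE n (M : 'M[F]_n) x : qform M x = bform M x x.
Proof. by []. Qed.

Section Laws.
Variables m n : nat.
Implicit Types (M N : 'M[F]_(m, n)) (x : 'cV[F]_m) (y : 'cV[F]_n).

Lemma bformDl M x1 x2 y : bform M (x1 + x2) y = bform M x1 y + bform M x2 y.
Proof. by rewrite /bform raddfD /= !mulmxDl mxE. Qed.

Lemma bformDr M x y1 y2 : bform M x (y1 + y2) = bform M x y1 + bform M x y2.
Proof. by rewrite /bform mulmxDr mxE. Qed.

Lemma bformNl M x y : bform M (- x) y = - bform M x y.
Proof. by rewrite /bform raddfN /= !mulNmx mxE. Qed.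

Lemma bformNr M x y : bform M x (- y) = - bform M x y.
Proof. by rewrite /bform mulmxN mxE. Qed.

Lemma bformZl M a x y : bform M (a *: x) y = a * bform M x y.
Proof. by rewrite /bform linearZ /= -!scalemxAl mxE. Qed.

Lemma bformZr M a x y : bform M x (a *: y) = a * bform M x y.
Proof. by rewrite /bform -scalemxAr mxE. Qed.

Lemma bform0l M y : bform M 0 y = 0.
Proof. by rewrite /bform trmx0 !mul0mx mxE. Qed.

Lemma bform0r M x : bform M x 0 = 0.
Proof. by rewrite /bform mulmx0 mxE. Qed.

Lemma bform_mxD M N x y : bform (M + N) x y = bform M x y + bform N x y.
Proof. by rewrite /bform mulmxDr mulmxDl mxE. Qed.

Lemma bform_mxN M x y : bform (- M) x y = - bform M x y.
Proof. by rewrite /bform mulmxN mulNmx mxE. Qed.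

Lemma bform_tr M x y : bform M^T y x = bform M x y.
Proof.
rewrite /bform.
have -> : y^T *m M^T *m x = (x^T *m M *m y)^T.
  by rewrite -mulmxA !trmx_mul trmxK.
by rewrite mxE.
Qed.

Lemma bform_mull p (C : 'M_(m, p)) M (x : 'cV_p) y :
  bform (C^T *m M) x y = bform M (C *m x) y.
Proof. by rewrite /bform trmx_mul !mulmxA. Qed.

Lemma bform_mulr p (C : 'M_(n, p)) M x (y : 'cV_p) :
  bform (M *m C) x y = bform M x (C *m y).
Proof. by rewrite /bform !mulmxA. Qed.

Lemma bform_sum M x y : bform M x y = \sum_i \sum_j M i j * x i 0 * y j 0.
Proof.
rewrite /bform mxE exchange_big /=; apply: eq_bigr => j _.
rewrite mxE mulr_suml; apply: eq_bigr => i _.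
by rewrite mxE (mulrC (x i 0)).
Qed.

Lemma bform_eq0 M : (forall x y, bform M x y = 0) -> M = 0.
Proof.
move=> M0; apply/matrixP => i j.
have := M0 (delta_mx i 0) (delta_mx j 0).
by rewrite /bform trmx_delta -rowE -colE !mxE.
Qed.

End Laws.

Lemma bform_congr m n p q (C : 'M_(m, p)) (D : 'M_(n, q)) (M : 'M[F]_(m, n)) x y :
  bform (C^T *m M *m D) x y = bform M (C *m x) (D *m y).
Proof. by rewrite bform_mulr bform_mull. Qed.

Lemma bform_block m n (M : 'M[F]_m) N N' (M' : 'M[F]_n) x u y v :
  bform (block_mx M N N' M') (col_mx x u) (col_mx y v) =
  bform M x y + bform N x v + bform N' u y + bform M' u v.
Proof.
rewrite /bform tr_col_mx mul_row_block mul_row_col !mulmxDl !mxE; ring.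
Qed.

Lemma bform_symC n (M : 'M[F]_n) x y :
  symmetric_mx M -> bform M x y = bform M y x.
Proof. by move=> sM; rewrite -{1}sM bform_tr. Qed.

Definition bformE :=
  (bform_mxD, bform_mxN, bformDl, bformDr, bformNl, bformNr,
   bformZl, bformZr, bform0l, bform0r).

Lemma qformD n (M : 'M[F]_n) x y : symmetric_mx M ->
  qform M (x + y) = qform M x + bform M x y *+ 2 + qform M y.
Proof. by move=> sM; rewrite !qformE !bformE (bform_symC y x sM); ring. Qed.

Lemma qformZ n (M : 'M[F]_n) a x : qform M (a *: x) = a ^+ 2 * qform M x.
Proof. by rewrite !qformE !bformE; ring. Qed.

Lemma qformN n (M : 'M[F]_n) x : qform M (- x) = qform M x.
Proof. by rewrite !qformE !bformE opprK. Qed.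

Lemma qform0 n (M : 'M[F]_n) : qform M 0 = 0.
Proof. exact: bform0l. Qed.

Lemma qform_mxD n (M N : 'M[F]_n) x : qform (M + N) x = qform M x + qform N x.
Proof. exact: bform_mxD. Qed.

Lemma qform_mxB n (M N : 'M[F]_n) x : qform (M - N) x = qform M x - qform N x.
Proof. by rewrite qformE bform_mxD bform_mxN. Qed.

Lemma symmetric_mxB n (M N : 'M[F]_n) :
  symmetric_mx M -> symmetric_mx N -> symmetric_mx (M - N).
Proof. by rewrite /symmetric_mx raddfB /= => -> ->. Qed.

Lemma symmetric_mxD n (M N : 'M[F]_n) :
  symmetric_mx M -> symmetric_mx N -> symmetric_mx (M + N).
Proof. by rewrite /symmetric_mx raddfD /= => -> ->. Qed.

Lemma symmetric_congr m n (M : 'M[F]_m) (C : 'M[F]_(m, n)) :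
  symmetric_mx M -> symmetric_mx (C^T *m M *m C).
Proof. by rewrite /symmetric_mx !trmx_mul trmxK mulmxA => ->. Qed.

Lemma sym_qform_eq0 n (M : 'M[F]_n) :
  symmetric_mx M -> (forall x, qform M x = 0) -> M = 0.
Proof.
move=> sM M0; apply: bform_eq0 => x y.
have := qformD x y sM; rewrite !M0 add0r addr0 => /esym/eqP.
by rewrite mulrn_eq0 => /eqP.
Qed.

Lemma sym_qform_inj n (M N : 'M[F]_n) : symmetric_mx M -> symmetric_mx N ->
  qform M =1 qform N -> M = N.
Proof.
move=> sM sN MN; apply/eqP; rewrite -subr_eq0; apply/eqP.
apply: sym_qform_eq0; first exact: symmetric_mxB.
by move=> x; rewrite qform_mxB MN subrr.
Qed.

Lemma dot_self_eq0 n (x : 'cV[F]_n) : (x^T *m x) 0 0 = 0 -> x = 0.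
Proof.
move=> x0; apply/matrixP => i j; rewrite ord1 [RHS]mxE.
move: x0; rewrite mxE.
under eq_bigr do rewrite mxE -expr2.
by move/psumr_eq0P => /(_ (fun i _ => sqr_ge0 _) i isT)/eqP;
  rewrite sqrf_eq0 => /eqP.
Qed.

Lemma psd_ker n (M : 'M[F]_n) z : possemidef M -> qform M z = 0 -> M *m z = 0.
Proof.
move=> [sM M0] z0; apply: dot_self_eq0.
set y := M *m z; set a := (y^T *m y) 0 0.
have aE : bform M y z = a by rewrite /bform -mulmxA.
apply/eqP/negPn/negP => a0.
(* Since the form vanishes at [z], it is affine along this line with slope [2 * a]; the coefficient
   is chosen to make its value -1. *)
have := M0 (y + (- (qform M y + 1) / (2 * a)) *: z).
rewrite qformD // qformZ z0 bformZr aE.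
have -> : - (qform M y + 1) / (2 * a) * a *+ 2 = - (qform M y + 1) by field.
lra.
Qed.

Lemma posdef_unit n (M : 'M[F]_n) : posdef M -> M \in unitmx.
Proof.
move=> [sM M0]; rewrite -unitmx_tr -row_free_unit.
apply: inj_row_free => v v0.
have Mv : M *m v^T = 0 by rewrite -[M]trmxK -trmx_mul v0 trmx0.
apply/eqP/negPn/negP => vn0.
have := M0 v^T; rewrite /qform -mulmxA Mv mulmx0 mxE ltxx.
by rewrite trmx_eq0 => /(_ vn0).
Qed.

(* Cauchy-Schwarz for the form M, applied to y and to w with M w = e_i. *)
Lemma posdef_coord_bound n (M : 'M[F]_n) : posdef M ->
  exists2 c : F, 0 <= c & forall (y : 'cV_n) i, (y i 0) ^+ 2 <= c * qform M y.
Proof.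
move=> pM; have [sM M0] := pM; have uM := posdef_unit pM.
pose w i : 'cV[F]_n := invmx M *m delta_mx i 0.
have M0' x : 0 <= qform M x.
  by have [->|/M0/ltW//] := eqVneq x 0; rewrite qform0.
exists (\sum_i qform M (w i)); first by apply: sumr_ge0 => i _.
move=> y i.
have wy : bform M (w i) y = y i 0.
  rewrite (bform_symC _ _ sM) /bform -mulmxA mulKVmx // -colE !mxE.
  by [].
have wpos : 0 < qform M (w i).
  apply: M0; apply/eqP => w0.
  have : M *m w i = delta_mx i 0 by rewrite mulKVmx.
  rewrite w0 mulmx0 => /matrixP/(_ i 0); rewrite !mxE !eqxx => /eqP.
  by rewrite eq_sym oner_eq0.
have CS : (y i 0) ^+ 2 <= qform M (w i) * qform M y.
  have := M0' (qform M (w i) *: y + (- y i 0) *: w i).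
  rewrite qformD // !qformZ bformZl bformZr (bform_symC y) // wy.
  set a := qform M (w i); set b := qform M y; set c := y i 0 => h.
  have {}h : 0 <= a * (a * b - c ^+ 2) by move: h; rewrite sqrrN; lra.
  by move: h; rewrite pmulr_rge0 // subr_ge0.
apply: (le_trans CS); apply: ler_wpM2r => //.
rewrite (bigD1 i) //= lerDl; apply: sumr_ge0 => j _; exact: M0'.
Qed.

Lemma qform_bound n (M : 'M[F]_n) (x : 'cV[F]_n) b :
  (forall i, (x i 0) ^+ 2 <= b) ->
  `|qform M x| <= (\sum_i \sum_j `|M i j|) * b.
Proof.
move=> xb; rewrite qformE bform_sum.
apply: (le_trans (ler_norm_sum _ _ _)); rewrite mulr_suml.
apply: ler_sum => i _.
apply: (le_trans (ler_norm_sum _ _ _)); rewrite mulr_suml.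
apply: ler_sum => j _; rewrite -mulrA normrM ler_wpM2l // ler_norml.
move: (xb i) (xb j); set s := x i 0; set t := x j 0 => hs ht.
have := sqr_ge0 (s + t); have := sqr_ge0 (s - t).
by rewrite !expr2 in hs ht *; move=> h1 h2; apply/andP; split; nra.
Qed.

Lemma bform_transpose_block m n (Q : 'M[F]_m) S (R : 'M[F]_n) x u :
  qform (block_mx Q S^T S R) (col_mx x u) =
  qform Q x + bform S u x *+ 2 + qform R u.
Proof. by rewrite !qformE bform_block bform_tr; ring. Qed.

Lemma pinv_sym n (M : 'M[F]_n) : symmetric_mx M -> symmetric_mx (pinv M).
Proof.
move=> sM; rewrite /symmetric_mx; have [M1 M2 M3 M4] := pinvP M.
apply: (@penrose_uniq _ _ _ M) (pinvP M); split.
- by apply: trmx_inj; rewrite !trmx_mul trmxK !sM mulmxA.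
- by apply: trmx_inj; rewrite !trmx_mul trmxK sM mulmxA.
- have -> : M *m (pinv M)^T = (pinv M *m M)^T by rewrite trmx_mul sM.
  by rewrite trmxK M4.
- have -> : (pinv M)^T *m M = (M *m pinv M)^T by rewrite trmx_mul sM.
  by rewrite trmxK M3.
Qed.

Lemma mulmx_cV_inj m n (M N : 'M[F]_(m, n)) :
  (forall x : 'cV_n, M *m x = N *m x) -> M = N.
Proof.
by move=> MN; apply/matrixP => i j; have /matrixP/(_ i 0) := MN (delta_mx j 0);
  rewrite -!colE !mxE.
Qed.

(** The range of $I-R^\dagger R$ is $\ker R$, so the inclusion gives $S^\top R^\dagger R=S^\top$;
    the claim is the transpose. *)
Lemma pinvKsub m n (R : 'M[F]_n) (S : 'M[F]_(n, m)) :
  symmetric_mx R -> ker_sub R S^T -> R *m (pinv R *m S) = S.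
Proof.
move=> sR kRS; have [R1 _ _ _] := pinvP R.
have S1 : S^T *m (pinv R *m R) = S^T.
  apply: mulmx_cV_inj => x; apply/eqP; rewrite -subr_eq0 -mulmxA -mulmxBr.
  by apply/eqP/kRS; rewrite mulmxBr !mulmxA R1 subrr.
by apply: trmx_inj; rewrite !trmx_mul (pinv_sym sR) sR -mulmxA S1.
Qed.

(** Completion of the square for a possibly singular [R]: the kernel inclusion replaces
    invertibility, through [R *m K = S]. *)
Lemma qform_block_square m n (Q : 'M[F]_m) S (R : 'M[F]_n) x u :
  symmetric_mx R -> ker_sub R S^T ->
  let K := pinv R *m S in
  qform (block_mx Q S^T S R) (col_mx x u) =
  qform (Q - S^T *m K) x + qform R (u + K *m x).
Proof.
move=> sR kRS K; have RK : R *m K = S by exact: pinvKsub.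
rewrite bform_transpose_block qform_mxB qformD // -bform_mulr RK.
have -> : qform R (K *m x) = qform (S^T *m K) x.
  by rewrite !qformE -bform_mulr RK bform_mulr bform_tr.
ring.
Qed.

(** The semidefinite form vanishes at the vector (0, v), so the whole block matrix kills it; the
    upper half of that equation is the claim. *)
Lemma psd_block_ker m n (Q : 'M[F]_m) S (R : 'M[F]_n) :
  possemidef (block_mx Q S^T S R) -> ker_sub R S^T.
Proof.
move=> pM v Rv; have := @psd_ker _ _ (col_mx 0 v) pM.
rewrite bform_transpose_block qform0 bform0r mul0rn !add0r.
rewrite /qform -mulmxA Rv mulmx0 mxE => /(_ erefl).
rewrite mul_block_col mulmx0 add0r => /(congr1 usubmx).
by rewrite col_mxKu linear0.
Qed.

Lemma psd_block_dr m n (Q : 'M[F]_m) S (R : 'M[F]_n) :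
  possemidef (block_mx Q S^T S R) -> possemidef R.
Proof.
move=> [sM M0]; split.
  by move: sM; rewrite /symmetric_mx tr_block_mx => /eq_block_mx[].
move=> v; have := M0 (col_mx 0 v).
by rewrite bform_transpose_block qform0 bform0r mul0rn !add0r.
Qed.

End BilinearForms.

(** * Spectral stability, geometric decay of powers, and Lyapunov forms *)

Section SchurStability.
Variable F : realType.

(* The rate is raised from r to 1 - (1 - r) * (1 - |z|) / 2, which exceeds both
   r and |z|. *)
Lemma recurrence_geometric (K : numFieldType) (z r c : K) (e y : nat -> K) :
  `|z| < 1 -> 0 <= r < 1 -> 0 <= c ->
  (forall k, y k.+1 = z * y k + e k) -> (forall k, `|e k| <= c * r ^+ k) ->
  exists r' c' : K, [/\ 0 <= r' < 1, 0 <= c' & forall k, `|y k| <= c' * r' ^+ k].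
Proof.
move=> z1 /andP[r0 r1] c0 yS ek.
have z0 := normr_ge0 z.
pose h := (1 - r) * (1 - `|z|) / 2.
have h0 : 0 < h by rewrite divr_gt0 // mulr_gt0 ?subr_gt0.
pose r' := 1 - h.
have rr' : r <= r'.
  have -> : r' = r + (1 - r) * (1 + `|z|) / 2 by rewrite /r' /h; field.
  by rewrite lerDl divr_ge0 // mulr_ge0 ?subr_ge0 ?(ltW r1) // addr_ge0.
have zr' : `|z| < r'.
  have -> : r' = `|z| + (1 - `|z|) * (1 + r) / 2 by rewrite /r' /h; field.
  by rewrite ltrDl divr_gt0 // mulr_gt0 // ?subr_gt0 // ltr_wpDr.
have r'0 : 0 <= r' by exact: le_trans rr'.
exists r', (`|y 0%N| + c / (r' - `|z|)); split.
- by rewrite r'0 /= /r' ltrBlDr ltrDl.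
- by rewrite addr_ge0 // divr_ge0 // ltW // subr_gt0.
set c' := _ + _.
have c'c : c <= (r' - `|z|) * c'.
  rewrite /c' mulrDr [X in _ + X]mulrCA divff ?mulr1; last first.
    by rewrite subr_eq0 gt_eqF.
  by rewrite lerDr mulr_ge0 // subr_ge0 ltW.
elim=> [|k IH].
  by rewrite expr0 mulr1 /c' lerDl divr_ge0 // ltW // subr_gt0.
rewrite yS; apply: (le_trans (ler_normD _ _)); rewrite normrM.
apply: (@le_trans _ _ (`|z| * (c' * r' ^+ k) + c * r' ^+ k)).
  apply: lerD; first exact: ler_wpM2l.
  by apply: (le_trans (ek k)); apply: ler_wpM2l => //; apply: lerXn2r.
rewrite mulrA -mulrDl exprS mulrA; apply: ler_wpM2r; first exact: exprn_ge0.
by move: c'c; rewrite mulrBl -lerBrDl mulrC.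
Qed.

(** A substitute for the Jordan form. Removing one root [z] from the annihilating product turns the
    scalar sequence into a first-order recurrence with multiplier [z], whose forcing term decays by
    induction. With all eigenvalues in [s] and [q] equal to 1 it bounds the entries of the
    powers. *)
Lemma peel_roots_geometric (K : numFieldType) n (M : 'M[K]_n.+1)
    (x : 'rV_n.+1) (y : 'cV_n.+1) (s : seq K) (q : {poly K}) :
  {in s, forall z, `|z| < 1} ->
  horner_mx M (\prod_(z <- s) ('X - z%:P) * q) = 0 ->
  exists r c : K, [/\ 0 <= r < 1, 0 <= c & forall k,
    `|(x *m (horner_mx M q *m (M ^+ k *m y))) 0 0| <= c * r ^+ k].
Proof.
elim: s q => [|z s IH] q sz.
  rewrite big_nil mul1r => ->; exists 0, 0; split=> // [|k].
    by rewrite lexx ltr01.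
  by rewrite mul0mx mulmx0 mxE normr0 mul0r.
(* The factor ['X - z%:P] moves from the product into [q]; the sequence belonging to the new [q] is
   the forcing term. *)
rewrite big_cons mulrAC -mulrA => sq.
have [||r [c [r01 c0 rc]]] := IH (q * ('X - z%:P)).
- by move=> t ts; apply: sz; rewrite inE ts orbT.
- by rewrite -[RHS]sq; congr (horner_mx _ _); ring.
apply: (recurrence_geometric (z := z) _ r01 c0 _ rc).
  by apply: sz; rewrite mem_head.
move=> k; rewrite rmorphM rmorphB /= horner_mx_X horner_mx_C.
have -> : horner_mx M q * (M - z%:M) = horner_mx M q *m M - z *: horner_mx M q.
  by rewrite mulrBr -!mulmxE scalar_mxC mul_scalar_mx.
rewrite mulmxBl mulmxBr -!scalemxAl -scalemxAr.
have -> : horner_mx M q *m M *m (M ^+ k *m y) =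
    horner_mx M q *m (M ^+ k.+1 *m y) by rewrite exprS -mulmxE !mulmxA.
move: (_ *m _) (x *m (_ *m (_ ^+ k.+1 *m _))) => X Y.
by rewrite !mxE; ring.
Qed.

Lemma schur_stable_geometric n (M : 'M[F]_n) : schur_stable M ->
  exists r c : F, [/\ 0 <= r < 1, 0 <= c &
    forall k i j, `|(M ^+ k) i j| <= c * r ^+ k].
Proof.
case: n M => [|n] M sM.
  by exists 0, 0; split=> // [|k []//]; rewrite lexx ltr01.
pose MC := map_mx (real_complex F) M.
have [s sE] := closed_field_poly_normal (char_poly MC).
move: sE; rewrite (monicP (char_poly_monic _)) scale1r => sE.
have s1 : {in s, forall z, `|z| < 1}.
  move=> z zs; apply: sM; rewrite eigenvalue_root_char sE.
  by rewrite root_prod_XsubC.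
have s0 : horner_mx MC (\prod_(z <- s) ('X - z%:P) * 1) = 0.
  by rewrite mulr1 -sE Cayley_Hamilton.
have H i j : exists rc : F * F, [/\ 0 <= rc.1 < 1, 0 <= rc.2 &
    forall k, `|(M ^+ k) i j| <= rc.2 * rc.1 ^+ k].
  have [r [c [/andP[r0 r1] c0 rc]]] :=
    peel_roots_geometric (delta_mx 0 i) (delta_mx j 0) s1 s0.
  (* In the order of the complex numbers, being nonnegative includes being real. *)
  have rE : r = (complex.Re r)%:C%C.
    by move: r0; rewrite lecE => /andP[/eqP]; case: (r) => a b /= ->.
  have cE : c = (complex.Re c)%:C%C.
    by move: c0; rewrite lecE => /andP[/eqP]; case: (c) => a b /= ->.
  exists (complex.Re r, complex.Re c) => /=.
  move: r0 r1 c0; rewrite rE cE !ler0c ltcR /= => r0 r1 c0.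
  split; [by rewrite r0 r1|by []|move=> k].
  have := rc k; rewrite rmorph1 mul1mx -rowE -colE !mxE.
  rewrite /MC -(rmorphXn (map_mx (real_complex F))) mxE rE cE /=.
  rewrite -rmorphXn -rmorphM /= normc_def /=.
  by rewrite expr0n addr0 sqrtr_sqr lecR.
have /choice[rc rcP] : forall p : 'I_n.+1 * 'I_n.+1, exists rc : F * F,
    [/\ 0 <= rc.1 < 1, 0 <= rc.2 &
        forall k, `|(M ^+ k) p.1 p.2| <= rc.2 * rc.1 ^+ k].
  by move=> p; exact: H.
(* The rates depend on the entry; the largest of these finitely many is still below 1. *)
pose r := \big[Num.max/0]_p (rc p).1.
have rle p : (rc p).1 <= r by exact: le_bigmax.
exists r, (\sum_p (rc p).2); split.
- apply/andP; split.
    by apply: le_trans (rle (0, 0)); have [/andP[]] := rcP (0, 0).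
  by apply: bigmax_lt => // p _; have [/andP[]] := rcP p.
- by apply: sumr_ge0 => p _; have [] := rcP p.
move=> k i j; have [/andP[r0 _] c0 /(_ k) /= h] := rcP (i, j).
apply: (le_trans h); apply: ler_pM => //.
- exact: exprn_ge0.
- rewrite (bigD1 (i, j)) //= lerDl; apply: sumr_ge0 => p _.
  by have [] := rcP p.
- by apply: lerXn2r => //; rewrite nnegrE ?(le_trans r0).
Qed.

Lemma geometric_cvg0 (r c : F) : 0 <= r < 1 -> (fun k => c * r ^+ k) @ \oo --> 0.
Proof.
move=> /andP[r0 r1]; rewrite -[X in _ --> X](mulr0 c); apply: cvgMr.
by apply: cvg_expr; rewrite ger0_norm.
Qed.

Lemma char_poly_trmx (K : comNzRingType) n (M : 'M[K]_n) :
  char_poly M^T = char_poly M.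
Proof.
rewrite /char_poly -[RHS]det_tr /char_poly_mx raddfB /= tr_scalar_mx.
by rewrite map_trmx.
Qed.

(** Real form of the criterion: [x] and [y] are the real and imaginary parts of an eigenvector, and
    [a], [b] those of its eigenvalue. *)
Lemma schur_stableP n (M : 'M[F]_n) :
  (forall x y : 'cV[F]_n, forall a b : F, (x != 0) || (y != 0) ->
    M *m x = a *: x - b *: y -> M *m y = b *: x + a *: y ->
    a ^+ 2 + b ^+ 2 < 1) -> schur_stable M.
Proof.
(* Eigenvectors here are rows; passing to the transpose yields one that [M] acts on as a column. *)
move=> H z; rewrite eigenvalue_root_char -char_poly_trmx -eigenvalue_root_char.
move=> /eigenvalueP[v vM v0].
pose x : 'cV[F]_n := \col_i complex.Re (v 0 i).
pose y : 'cV[F]_n := \col_i complex.Im (v 0 i).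
have vE i : v 0 i = (x i 0 +i* y i 0)%C by rewrite !mxE; case: (v 0 i).
have Mv i : (((M *m x) i 0) +i* ((M *m y) i 0))%C = z * v 0 i.
  have /matrixP/(_ 0 i) := vM; rewrite !mxE => <-.
  under [RHS]eq_bigr => j _ do rewrite vE !mxE.
  apply/eqP; rewrite eq_complex /= !raddf_sum /=; apply/andP; split; apply/eqP;
    apply: eq_bigr => j _; rewrite !mxE /=; ring.
have xy0 : (x != 0) || (y != 0).
  apply/negPn/negP; rewrite negb_or !negbK => /andP[/eqP x0 /eqP y0].
  move/eqP: v0; apply; apply/rowP => i.
  by rewrite vE x0 y0 !mxE.
have := H x y (complex.Re z) (complex.Im z) xy0.
have E1 : M *m x = complex.Re z *: x - complex.Im z *: y.
  apply/matrixP => i j; rewrite ord1; have := congr1 (@complex.Re _) (Mv i).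
  by rewrite vE /= => ->; case: (z) => a b /=; rewrite !mxE.
have E2 : M *m y = complex.Im z *: x + complex.Re z *: y.
  apply/matrixP => i j; rewrite ord1; have := congr1 (@complex.Im _) (Mv i).
  by rewrite vE /= => ->; case: (z) => a b /=; rewrite !mxE addrC.
move=> /(_ E1 E2) ab; rewrite normc_def -[1]/(1%:C)%C ltcR.
by rewrite -sqrtr1 ltr_sqrt.
Qed.

(** For an eigenvector $x+iy$ of eigenvalue $z$, applying [M] multiplies $V(x)+V(y)$ by $|z|^2$,
    while strict decrease at the nonzero part makes this sum drop. *)
Lemma lyapunov_schur_stable n (M V : 'M[F]_n) : posdef V ->
  (forall x, x != 0 -> qform V (M *m x) < qform V x) -> schur_stable M.
Proof.
move=> [sV V0] dV; apply: schur_stableP => x y a b xy Mx My.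
have V0' x' : 0 <= qform V x'.
  by have [->|/V0/ltW//] := eqVneq x' 0; rewrite qform0.
have dV' x' : qform V (M *m x') <= qform V x'.
  by have [->|/dV/ltW//] := eqVneq x' 0; rewrite mulmx0.
have lt : qform V (M *m x) + qform V (M *m y) < qform V x + qform V y.
  by have [x0|y0] := orP xy; [apply: ltr_leD|apply: ler_ltD]; rewrite ?dV ?dV'.
have W0 : 0 < qform V x + qform V y.
  by have [x0|y0] := orP xy; [apply: ltr_wpDr|apply: ltr_wpDl]; rewrite ?V0 ?V0'.
have E : qform V (M *m x) + qform V (M *m y) =
    (a ^+ 2 + b ^+ 2) * (qform V x + qform V y).
  rewrite Mx My !qformE !bformE (bform_symC y x sV); ring.
by move: lt; rewrite E gtr_pMl.
Qed.

End SchurStability.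

(** * Limits of matrices, of quadratic forms and of stable iterations *)

Section Limits.
Variable F : realType.

Lemma cvg_ge_eventually N (f : nat -> F) (a b : F) : f @ \oo --> a ->
  (forall k, (N <= k)%N -> b <= f k) -> b <= a.
Proof.
by move=> fa bf; apply: (cvgr_to_ge fa); exists N => // k /= Nk; exact: bf.
Qed.

Lemma cvg_sum (I : Type) (s : seq I) (f : I -> nat -> F) (l : I -> F) :
  (forall i, f i @ \oo --> l i) ->
  (fun k => \sum_(i <- s) f i k) @ \oo --> \sum_(i <- s) l i.
Proof.
move=> fl; elim: s => [|i s IH].
  by rewrite big_nil; under eq_fun do rewrite big_nil; exact: cvg_cst.
by rewrite big_cons; under eq_fun do rewrite big_cons; exact: cvgD.
Qed.

Definition mx_cvg m n (M_ : nat -> 'M[F]_(m, n)) (M : 'M[F]_(m, n)) : Prop :=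
  forall i j, (fun k => M_ k i j) @ \oo --> M i j.

Lemma mx_cvg_qform n x (M_ : nat -> 'M[F]_n) M : mx_cvg M_ M ->
  (fun k => qform (M_ k) x) @ \oo --> qform M x.
Proof.
move=> MM; rewrite qformE bform_sum.
under eq_fun do rewrite qformE bform_sum.
apply: cvg_sum => i; apply: cvg_sum => j.
by do 2!apply: cvgMl.
Qed.

Lemma mx_cvg_dist n (M_ : nat -> 'M[F]_n) M : mx_cvg M_ M ->
  (fun k => \sum_i \sum_j `|(M - M_ k) i j|) @ \oo --> 0.
Proof.
move=> MM.
have E : \sum_(i < n) \sum_(j < n) `|M i j - M i j| = 0 :> F.
  by rewrite big1 // => i _; rewrite big1 // => j _; rewrite subrr normr0.
rewrite -[X in _ --> X]E.
apply: cvg_sum => i; apply: cvg_sum => j.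
under eq_fun do rewrite !mxE.
by apply: cvg_norm; apply: cvgB; [exact: cvg_cst|exact: MM].
Qed.

Lemma qform_monotone_cvg n (M_ : nat -> 'M[F]_n) :
  (forall k, symmetric_mx (M_ k)) ->
  (forall x k, qform (M_ k) x <= qform (M_ k.+1) x) ->
  (forall x, exists C, forall k, qform (M_ k) x <= C) ->
  exists2 M, symmetric_mx M & mx_cvg M_ M.
Proof.
move=> sM inc bnd.
have cv x : cvgn (fun k => qform (M_ k) x).
  apply: nondecreasing_is_cvgn; first by apply/nondecreasing_seqP => k; exact: inc.
  have [C HC] := bnd x; exists C => _ [k _ <-]; exact: HC.
(* Polarization expresses each entry through three values of the form, all of which converge by
   monotonicity. *)
have entry i j : cvgn (fun k => M_ k i j).
  pose e k : 'cV[F]_n := delta_mx k 0.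
  have E k : M_ k i j = 2^-1 * (qform (M_ k) (e i + e j) - qform (M_ k) (e i)
      - qform (M_ k) (e j)).
    have -> : M_ k i j = bform (M_ k) (e i) (e j).
      by rewrite /bform trmx_delta -rowE -colE !mxE.
    by rewrite qformD //; field.
  under eq_fun do rewrite E.
  by apply: is_cvgMr; do 2?apply: is_cvgB; exact: cv.
exists (\matrix_(i, j) limn (fun k => M_ k i j)).
  apply/matrixP => i j; rewrite !mxE; congr (limn _); apply/funext => k.
  by rewrite -[in LHS](sM k) mxE.
by move=> i j; rewrite mxE; exact: entry.
Qed.

(** A vanishing state is recorded as one null sequence [e] bounding all squared coordinates, which
    is what [posdef_coord_bound] delivers. *)
Lemma qform_vanish n (W : 'M[F]_n) (x : nat -> 'cV[F]_n) (e : nat -> F) :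
  e @ \oo --> 0 -> (forall k i, (x k i 0) ^+ 2 <= e k) ->
  (fun k => qform W (x k)) @ \oo --> 0.
Proof.
move=> e0 xe; set c := \sum_i \sum_j `|W i j|.
have ce : (fun k => c * e k) @ \oo --> 0.
  by rewrite -[X in _ --> X](mulr0 c); exact: cvgMr.
have h k : - (c * e k) <= qform W (x k) <= c * e k.
  by rewrite -ler_norml; apply: qform_bound => i; exact: xe.
apply: (squeeze_cvgr _ _ ce); first by near=> k; exact: h.
by rewrite -oppr0; exact: cvgN.
Unshelve. all: by end_near.
Qed.

Lemma schur_stable_iter n (M : 'M[F]_n) : schur_stable M ->
  exists r c : F, [/\ 0 <= r < 1, 0 <= c &
    forall k (x : 'cV_n) b, (forall i, `|x i 0| <= b) ->
      forall i, `|(M ^+ k *m x) i 0| <= c * r ^+ k * b].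
Proof.
move/schur_stable_geometric => [r [c [r01 c0 Mk]]].
exists r, (c *+ n); split=> // [|k x b xb i]; first exact: mulrn_wge0.
rewrite mxE; apply: (le_trans (ler_norm_sum _ _ _)).
apply: (@le_trans _ _ (\sum_(j < n) c * r ^+ k * b)).
  apply: ler_sum => j _; rewrite normrM; apply: ler_pM => //; exact: Mk.
by rewrite sumr_const card_ord !mulrnAl.
Qed.

Lemma cV_coord_bound n (x : 'cV[F]_n) i : `|x i 0| <= `|x|.
Proof. by rewrite [leRHS]mx_normrE; exact: (le_bigmax _ _ (i, 0)). Qed.

Lemma schur_stable_vanish n (M : 'M[F]_n) (x : 'cV_n) : schur_stable M ->
  exists2 e : nat -> F, e @ \oo --> 0 &
    forall k i, ((M ^+ k *m x) i 0) ^+ 2 <= e k.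
Proof.
move/schur_stable_iter => [r [c [r01 c0 Mk]]].
exists (fun k => (`|x| * c * r ^+ k) ^+ 2).
  rewrite -[X in _ --> X](expr0n F 2).
  under eq_fun do rewrite expr2.
  by rewrite expr2; apply: cvgM; exact: geometric_cvg0.
have [r0 _] := andP r01.
move=> k i; rewrite -[leLHS]real_normK ?num_real //.
apply: lerXn2r; rewrite ?nnegrE //.
  by rewrite mulr_ge0 ?exprn_ge0 // mulr_ge0.
by rewrite -mulrA mulrC; apply: Mk => j; exact: cV_coord_bound.
Qed.

End Limits.

Arguments cvg_ge_eventually {F} N {f a b}.
Arguments mx_cvg_qform {F n} x {M_ M}.

(** * Returning to the origin by the characteristic polynomial *)

Section HornerTrajectory.
Variable F : realType.

(** The state reached from 0 with input direction [b] when the scalars of [s] are applied from the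
    last to the first; it is $p(M)b$ for the polynomial with coefficients [s]. *)
Fixpoint horner_state n (M : 'M[F]_n) (b : 'cV[F]_n) (s : seq F) : 'cV[F]_n :=
  if s is c :: s' then M *m horner_state M b s' + c *: b else 0.

Lemma horner_stateE n (M : 'M[F]_n.+1) b s :
  horner_state M b s = horner_mx M (Poly s) *m b.
Proof.
elim: s => [|c s IH] /=; first by rewrite rmorph0 mul0mx.
rewrite IH cons_poly_def mulrC rmorphD rmorphM /= horner_mx_X horner_mx_C.
by rewrite mulmxDl -mulmxE -mulmxA mul_scalar_mx.
Qed.

(** The inputs are the coefficients of the characteristic polynomial, which is monic of positive
    degree since [b] is nonzero. The two last entries are displayed because the final 1 brings the
    state from 0 to [b], so that the step with input [c] starts at a nonzero state, where a strict
    increase is available. *)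
Lemma horner_state_return n (M : 'M[F]_n) b : b != 0 ->
  exists s c, horner_state M b (s ++ [:: c; 1]) = 0.
Proof.
case: n M b => [|n] M b; first by rewrite [b]flatmx0 eqxx.
move=> _; have := size_char_poly M; have /monicP := char_poly_monic M.
have := Cayley_Hamilton M; rewrite -{1}[char_poly M]polyseqK lead_coefE.
move: (char_poly M : seq F) => p.
case/lastP: p => [|p a]; first by [].
case/lastP: p => [|p c]; first by [].
move=> CH; rewrite size_rcons => + sp; rewrite nth_rcons ltnn eqxx => a1.
exists p, c; rewrite -a1 horner_stateE.
by rewrite -!cats1 -catA in CH; rewrite CH mul0mx.
Qed.

End HornerTrajectory.

(** * The form $H_P$, its completed square and the Riccati operator *)

Section Riccati.
Variables (F : realType) (nx nu : nat).
Variables (A : 'M[F]_nx) (B : 'M[F]_(nx, nu)).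
Variables (Q : 'M[F]_nx) (S : 'M[F]_(nu, nx)) (R : 'M[F]_nu).
Hypothesis sym_cost : symmetric_mx (cost_mx Q S R).

Local Notation QM := (QM A Q).
Local Notation SM := (SM A B S).
Local Notation RM := (RM B R).
Local Notation HM := (HM A B Q S R).
Local Notation cost x u := (qform (cost_mx Q S R) (col_mx x u)).
Local Notation hcost P x u := (qform (HM P) (col_mx x u)).
Local Notation gain := (cgdare_gain A B S R).

(** Generalized Schur complement of $R_P$ in $H_P$; when $H_P\succeq0$ it is the minimum of the form
    $H_P$ over the input. *)
Definition riccati_residual (P : 'M[F]_nx) : 'M[F]_nx :=
  QM P - (SM P)^T *m gain P.

Lemma sym_Q : symmetric_mx Q.
Proof. by move: sym_cost; rewrite /symmetric_mx tr_block_mx => /eq_block_mx[]. Qed.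

Lemma sym_R : symmetric_mx R.
Proof. by move: sym_cost; rewrite /symmetric_mx tr_block_mx => /eq_block_mx[]. Qed.

Lemma sym_QM P : symmetric_mx P -> symmetric_mx (QM P).
Proof.
move=> sP; apply: symmetric_mxB => //; apply: symmetric_mxD; first exact: sym_Q.
exact: symmetric_congr.
Qed.

Lemma sym_RM P : symmetric_mx P -> symmetric_mx (RM P).
Proof.
by move=> sP; apply: symmetric_mxD; [exact: sym_R|exact: symmetric_congr].
Qed.

Lemma sym_HM P : symmetric_mx P -> symmetric_mx (HM P).
Proof.
move=> sP; rewrite /symmetric_mx tr_block_mx trmxK.
by rewrite (sym_QM sP) (sym_RM sP).
Qed.

Lemma sym_riccati_residual P : symmetric_mx P ->
  symmetric_mx (riccati_residual P).
Proof.
move=> sP; apply: symmetric_mxB; first exact: sym_QM.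
rewrite /symmetric_mx !trmx_mul trmxK.
by rewrite (pinv_sym (sym_RM sP)) mulmxA.
Qed.

Lemma HM_qform P x u : symmetric_mx P ->
  hcost P x u = cost x u + qform P (A *m x + B *m u) - qform P x.
Proof.
move=> sP; rewrite /cost_mx !bform_transpose_block (qformD _ _ sP).
rewrite !qformE !bform_mxD !bform_mxN !bform_congr.
rewrite (bform_symC (A *m x) (B *m u) sP).
ring.
Qed.

(** The stage cost cancels, so two matrices can be compared along one step; the monotonicity
    arguments below read their signs off this identity. *)
Lemma HM_sub P P' x u : symmetric_mx P -> symmetric_mx P' ->
  hcost P x u - hcost P' x u =
  qform (P - P') (A *m x + B *m u) - qform (P - P') x.
Proof. by move=> sP sP'; rewrite !HM_qform // !qform_mxB; ring. Qed.

Lemma sum_HM P x u x0 N : symmetric_mx P -> trajectory A B x0 x u ->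
  \sum_(0 <= k < N) hcost P (x k) (u k) =
  \sum_(0 <= k < N) cost (x k) (u k) + qform P (x N) - qform P x0.
Proof.
move=> sP [<- xS]; elim: N => [|N IH].
  by rewrite !big_geq // add0r subrr.
by rewrite !big_nat_recr //= IH HM_qform // -xS; ring.
Qed.

Lemma HM_square P x u : symmetric_mx P -> ker_sub (RM P) (SM P)^T ->
  hcost P x u = qform (riccati_residual P) x + qform (RM P) (u + gain P *m x).
Proof. by move=> sP kP; rewrite qform_block_square //; exact: sym_RM. Qed.

Lemma RM_qform P u : qform (RM P) u = qform R u + qform P (B *m u).
Proof. by rewrite qform_mxD [X in _ + X]qformE bform_congr. Qed.

Lemma closed_loopE (K : 'M[F]_(nu, nx)) (y : 'cV_nx) :
  A *m y + B *m - (K *m y) = (A - B *m K) *m y.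
Proof. by rewrite mulmxBl mulmxN mulmxA. Qed.

Lemma possemidef_HM P : symmetric_mx P ->
  (forall x u, 0 <= hcost P x u) -> possemidef (HM P).
Proof.
move=> sP P0; split; first exact: sym_HM.
by move=> z; rewrite -[z]vsubmxK.
Qed.

Lemma hcost_ge0 P x u : possemidef (HM P) -> 0 <= hcost P x u.
Proof. by move=> [_]; exact. Qed.

Lemma RM_ge0 P v : possemidef (HM P) -> 0 <= qform (RM P) v.
Proof. by move/psd_block_dr => [_]; exact. Qed.

Lemma HM_ker P : possemidef (HM P) -> ker_sub (RM P) (SM P)^T.
Proof. exact: psd_block_ker. Qed.

Lemma residual_le_hcost P x u : symmetric_mx P -> possemidef (HM P) ->
  qform (riccati_residual P) x <= hcost P x u.
Proof.
by move=> sP pP; rewrite HM_square // ?lerDl; [exact: RM_ge0|exact: HM_ker].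
Qed.

Lemma hcost_gain P x : symmetric_mx P -> ker_sub (RM P) (SM P)^T ->
  hcost P x (- (gain P *m x)) = qform (riccati_residual P) x.
Proof. by move=> sP kP; rewrite HM_square // addNr qform0 addr0. Qed.

Lemma residual_ge0 P x : symmetric_mx P -> possemidef (HM P) ->
  0 <= qform (riccati_residual P) x.
Proof.
move=> sP pP; rewrite -hcost_gain //; first exact: hcost_ge0.
exact: HM_ker.
Qed.

(** The [- P] inside [QM] cancels, which leaves the Riccati difference operator, one step of dynamic
    programming. *)
Definition riccati_step (P : 'M[F]_nx) : 'M[F]_nx := P + riccati_residual P.

Lemma riccati_step_qform P x :
  qform (riccati_step P) x = qform P x + qform (riccati_residual P) x.
Proof. exact: qform_mxD. Qed.

Lemma sym_riccati_step P : symmetric_mx P -> symmetric_mx (riccati_step P).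
Proof. by move=> sP; apply: symmetric_mxD => //; exact: sym_riccati_residual. Qed.

Lemma riccati_step_ge P x : symmetric_mx P -> possemidef (HM P) ->
  qform P x <= qform (riccati_step P) x.
Proof. by move=> sP pP; rewrite qform_mxD lerDl residual_ge0. Qed.

(** The new form is the old one plus the residual at the successor minus the residual at [x];
    subtracting the latter leaves the square in $R_P$. *)
Lemma riccati_step_psd P : symmetric_mx P -> possemidef (HM P) ->
  possemidef (HM (riccati_step P)).
Proof.
move=> sP pP; have sP' := sym_riccati_step sP.
apply: possemidef_HM => // x u; have kP := HM_ker pP.
have := HM_sub x u sP' sP; rewrite (HM_square _ _ sP kP).
have -> : riccati_step P - P = riccati_residual P by rewrite addrC addKr.
have := RM_ge0 (u + gain P *m x) pP.
have := residual_ge0 (A *m x + B *m u) sP pP.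
lra.
Qed.

Lemma cgdare_residual P : cgdare A B Q S R P -> riccati_residual P = 0.
Proof. by case=> _ P0 _; rewrite /riccati_residual -P0. Qed.

Lemma cgdare_HM P x u : cgdare A B Q S R P ->
  hcost P x u = qform (RM P) (u + gain P *m x).
Proof.
move=> cP; have [sP _ kP] := cP.
by rewrite HM_square // (cgdare_residual cP) /qform mulmx0 mul0mx mxE add0r.
Qed.

(** * Consequences of strict pre-dissipativity with storage matrix [L] *)

Section Predissipative.
Variable L : 'M[F]_nx.
Hypotheses (sL : symmetric_mx L) (pL : possemidef (HM L)).
Hypothesis dL : posdef (riccati_residual L).

Lemma hcost_gt0 x u : x != 0 -> 0 < hcost L x u.
Proof.
by move=> x0; apply: lt_le_trans (residual_le_hcost _ _ sL pL); apply: dL.2.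
Qed.

(* Inputs in ker (RM P) on top of the feedback cost nothing for HM P, so L - P
   strictly increases along the resulting trajectories, while by Cayley-Hamilton
   one of them leads from 0 through B v back to 0. *)
Lemma cgdare_ker P (v : 'cV_nu) : cgdare A B Q S R P -> RM P *m v = 0 ->
  B *m v = 0 /\ R *m v = 0.
Proof.
move=> cP Rv; have [sP _ kP] := cP.
suff Bv : B *m v = 0.
  by split=> //; move: Rv; rewrite mulmxDl -!mulmxA Bv !mulmx0 addr0.
apply/eqP/negPn/negP => Bv0.
pose AK := A - B *m gain P; pose st := horner_state AK (B *m v).
have stS c s : let w := - (gain P *m st s) + c *: v in
    qform (L - P) (st (c :: s)) = qform (L - P) (st s) + hcost L (st s) w.
  move=> w; have -> : st (c :: s) = A *m st s + B *m w.
    by rewrite /st /= mulmxBl mulmxDr mulmxN !mulmxA addrA scalemxAr.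
  have := HM_sub (st s) w sL sP; rewrite (cgdare_HM _ _ cP).
  have -> : qform (RM P) (w + gain P *m st s) = 0.
    by rewrite addrC addNKr qformZ /qform -mulmxA Rv mulmx0 mxE mulr0.
  lra.
have D1 : 0 <= qform (L - P) (st [:: 1]).
  by rewrite stS [st [::]]/= qform0 add0r hcost_ge0.
have D2 s c : 0 < qform (L - P) (st (s ++ [:: c; 1])).
  elim: s => [|c' s IH].
    rewrite cat0s stS ltr_wpDl // hcost_gt0 //.
    by rewrite /st /= mulmx0 add0r scale1r.
  by rewrite cat_cons stS ltr_wpDr // hcost_ge0.
have [s [c sc]] := horner_state_return AK Bv0.
by have := D2 s c; rewrite /st sc qform0 ltxx.
Qed.

(** * Value iteration; existence, maximality and uniqueness of the stabilizing solution *)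

Definition value_iter k : 'M[F]_nx := iter k riccati_step L.

Lemma value_iterS k : value_iter k.+1 = riccati_step (value_iter k).
Proof. by []. Qed.

Lemma sym_value_iter k : symmetric_mx (value_iter k).
Proof. by elim: k => [|k IH] //; exact: sym_riccati_step. Qed.

Lemma value_iter_psd k : possemidef (HM (value_iter k)).
Proof.
by elim: k => [|k IH] //; apply: riccati_step_psd => //; exact: sym_value_iter.
Qed.

Lemma value_iter_inc x k :
  qform (value_iter k) x <= qform (value_iter k.+1) x.
Proof.
by apply: riccati_step_ge; [exact: sym_value_iter|exact: value_iter_psd].
Qed.

Lemma value_iter_mono x k l : (k <= l)%N ->
  qform (value_iter k) x <= qform (value_iter l) x.
Proof.
move=> /subnKC <-; elim: (l - k)%N => [|m IH]; first by rewrite addn0.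
by rewrite addnS; apply: le_trans IH (value_iter_inc _ _).
Qed.

Lemma value_iter_le k x u : qform (value_iter k.+1) x <=
  cost x u + qform (value_iter k) (A *m x + B *m u).
Proof.
have sk := sym_value_iter k.
have := residual_le_hcost x u sk (value_iter_psd k).
by rewrite HM_qform // value_iterS riccati_step_qform; lra.
Qed.

Lemma value_iter_le_cost N k x u : (forall j, x j.+1 = A *m x j + B *m u j) ->
  qform (value_iter (N + k)) (x 0%N) <=
  \sum_(0 <= j < N) cost (x j) (u j) + qform (value_iter k) (x N).
Proof.
elim: N x u => [|N IH] x u xS; first by rewrite big_geq // add0r.
rewrite big_nat_recl //= -addrA.
apply: (le_trans (value_iter_le _ _ (u 0%N))); rewrite lerD2l -xS.
exact: (IH (fun j => x j.+1) (fun j => u j.+1)).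
Qed.

Lemma value_iter_bounded : controllable A B ->
  forall x, exists C, forall k, qform (value_iter k) x <= C.
Proof.
move=> ctrl x0; have [N [x [u [[<- xS] xN]]]] := ctrl x0 0.
exists (\sum_(0 <= j < N) cost (x j) (u j)) => k.
(* Raising the index to [N + k] leaves [k] iterations for the state at time [N], which is 0, so the
   bound does not depend on [k]. *)
apply: (le_trans (value_iter_mono _ (leq_addl N k))).
by apply: (le_trans (value_iter_le_cost _ _ xS)); rewrite xN qform0 addr0.
Qed.

(* The greedy successors y_k of x under the iterates stay bounded because
   riccati_residual L is positive definite, so the residual of the limit at x
   is at most (P - value_iter k)(y_k), which vanishes. *)
Lemma cgdare_exists : controllable A B -> exists P,
  [/\ cgdare A B Q S R P, possemidef (HM P), posdef (P - L)
    & schur_stable (A - B *m gain P)].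
Proof.
move=> ctrl.
have [P sP cvP] := qform_monotone_cvg sym_value_iter value_iter_inc
  (value_iter_bounded ctrl).
have leP k x : qform (value_iter k) x <= qform P x.
  apply: (cvg_ge_eventually k (mx_cvg_qform x cvP)) => l kl.
  exact: (value_iter_mono x kl).
have pP : possemidef (HM P).
  apply: possemidef_HM => // x u; rewrite HM_qform //.
  have lim : (fun k => cost x u + qform (value_iter k) (A *m x + B *m u)
      - qform (value_iter k) x) @ \oo --> cost x u + qform P (A *m x + B *m u)
      - qform P x.
    apply: cvgB; last exact: mx_cvg_qform.
    by apply: cvgD; [exact: cvg_cst|exact: mx_cvg_qform].
  apply: (cvg_ge_eventually 0 lim) => k _.
  rewrite -HM_qform; last exact: sym_value_iter.
  by apply: hcost_ge0; exact: value_iter_psd.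
have [c c0 coord] := posdef_coord_bound dL.
have res x : qform (riccati_residual P) x <= 0.
  pose u k := - (gain (value_iter k) *m x).
  pose y k := A *m x + B *m u k.
  have step k : hcost (value_iter k) x (u k) =
      qform (value_iter k.+1) x - qform (value_iter k) x.
    rewrite hcost_gain; last 2 first.
    - exact: sym_value_iter.
    - by apply: HM_ker; exact: value_iter_psd.
    by rewrite value_iterS riccati_step_qform addrC addKr.
  (* The shift to [k.+1] matters: from iterate 1 on, the excess over [L] dominates the positive
     definite residual of [L], while iterate 0 is [L] itself. *)
  have yb k i : (y k.+1 i 0) ^+ 2 <= c * qform (P - L) x.
    apply: (le_trans (coord _ _)); apply: ler_wpM2l => //.
    have := HM_sub x (u k.+1) (sym_value_iter k.+1) sL.
    rewrite step -/(y k.+1) (qform_mxB P L) !(qform_mxB (value_iter k.+1) L).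
    have := hcost_ge0 x (u k.+1) pL; have := leP k.+2 x.
    have : qform (riccati_step L) (y k.+1) <= qform (value_iter k.+1) (y k.+1).
      exact: (@value_iter_mono _ 1).
    rewrite riccati_step_qform; lra.
  have resk k : qform (riccati_residual P) x <= qform (P - value_iter k) (y k).
    apply: (le_trans (residual_le_hcost x (u k) sP pP)).
    have := HM_sub x (u k) sP (sym_value_iter k).
    rewrite step -/(y k) !qform_mxB; have := leP k.+1 x; lra.
  pose d k := \sum_i \sum_j `|(P - value_iter k) i j|.
  have d0 : (fun k => d k.+1 * (c * qform (P - L) x)) @ \oo --> 0.
    rewrite -[X in _ --> X](mul0r (c * qform (P - L) x)); apply: cvgMl.
    by rewrite (cvg_shiftS d); exact: mx_cvg_dist.
  apply: (cvg_ge_eventually 0 d0) => k _.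
  apply: (le_trans (resk k.+1)); apply: (le_trans (ler_norm _)).
  by apply: qform_bound => i; exact: yb.
have res0 : riccati_residual P = 0.
  apply: sym_qform_eq0 => [|x]; first exact: sym_riccati_residual.
  by apply/eqP; rewrite eq_le res residual_ge0.
have cP : cgdare A B Q S R P by split; [|exact: esym res0|exact: HM_ker].
have dPL : posdef (P - L).
  split=> [|x x0]; first exact: symmetric_mxB.
  have : qform (riccati_step L) x <= qform P x by exact: (leP 1%N).
  rewrite riccati_step_qform (qform_mxB P L).
  have := dL.2 x x0; lra.
exists P; split=> //; apply: lyapunov_schur_stable dPL _ => x x0.
have := HM_sub x (- (gain P *m x)) sP sL.
rewrite closed_loopE cgdare_HM // addNr qform0.
have := hcost_gt0 (- (gain P *m x)) x0; lra.
Qed.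

(** Along the closed loop of [P] the form [HM P] vanishes and [HM P'] is nonnegative, so the form of
    [P - P'] does not increase; its limit is 0 by stability. *)
Lemma stabilizing_max P P' x :
  cgdare A B Q S R P -> schur_stable (A - B *m gain P) ->
  symmetric_mx P' -> possemidef (HM P') -> qform P' x <= qform P x.
Proof.
move=> cP st sP' pP'; have [sP _ _] := cP; set M := A - B *m gain P in st.
have dec k : qform (P - P') (M ^+ k.+1 *m x) <= qform (P - P') (M ^+ k *m x).
  rewrite exprS -mulmxE -mulmxA; set y := M ^+ k *m x.
  have := HM_sub y (- (gain P *m y)) sP sP'.
  rewrite closed_loopE -/M cgdare_HM // addNr qform0.
  have := hcost_ge0 y (- (gain P *m y)) pP'; lra.
have le0 k : qform (P - P') (M ^+ k *m x) <= qform (P - P') x.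
  elim: k => [|k IH]; first by rewrite expr0 mul1mx.
  exact: le_trans (dec k) IH.
have [e e0 xe] := schur_stable_vanish x st.
have : - qform (P - P') x <= - 0.
  apply: (cvg_ge_eventually 0 (cvgN (qform_vanish (P - P') e0 xe))) => k _.
  by rewrite lerN2.
by rewrite lerN2 qform_mxB subr_ge0.
Qed.

(** For a solution, $H_P$ is a square in $R_P$, and maximality over [L] gives $R_P\succeq
    R_L\succeq0$. *)
Lemma stabilizing_psd P : cgdare A B Q S R P ->
  schur_stable (A - B *m gain P) -> possemidef (HM P).
Proof.
move=> cP st; have [sP _ _] := cP; apply: possemidef_HM => // x u.
rewrite cgdare_HM // RM_qform.
have := stabilizing_max (B *m (u + gain P *m x)) cP st sL pL.
have := RM_ge0 (u + gain P *m x) pL.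
rewrite RM_qform; lra.
Qed.

Lemma stabilizing_uniq P P' :
  cgdare A B Q S R P -> schur_stable (A - B *m gain P) ->
  cgdare A B Q S R P' -> schur_stable (A - B *m gain P') -> P = P'.
Proof.
move=> cP st cP' st'; have [sP _ _] := cP; have [sP' _ _] := cP'.
apply: sym_qform_inj => // x; apply/le_anti/andP; split.
- by apply: stabilizing_max => //; exact: stabilizing_psd.
- by apply: stabilizing_max => //; exact: stabilizing_psd.
Qed.

(** * The projector $G$ and the equivalence of rDARE and CGDARE *)

Section Regularization.
Variable P0 : 'M[F]_nx.
Hypothesis cP0 : cgdare A B Q S R P0.
Local Notation G := (Gmx B R P0).

(** [P] is arbitrary here: the range of [G] is $\ker R_{P_0}$, which both [B] and [R] annihilate. *)
Lemma RM_G P : RM P *m G = 0.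
Proof.
have [R1 _ _ _] := pinvP (RM P0).
have RG (v : 'cV_nu) : B *m (G *m v) = 0 /\ R *m (G *m v) = 0.
  apply: (cgdare_ker cP0).
  by rewrite mulmxA mulmxBr mulmx1 mulmxA R1 subrr mul0mx.
apply: mulmx_cV_inj => v; rewrite mul0mx -mulmxA mulmxDl -mulmxA.
by have [-> ->] := RG v; rewrite mulmx0 addr0.
Qed.

Lemma B_G : B *m G = 0.
Proof.
have [R1 _ _ _] := pinvP (RM P0).
apply: mulmx_cV_inj => v; rewrite mul0mx -mulmxA; apply: (cgdare_ker cP0 _).1.
by rewrite mulmxA mulmxBr mulmx1 mulmxA R1 subrr mul0mx.
Qed.

Lemma sym_G : symmetric_mx G.
Proof.
by have [_ _ _ R4] := pinvP (RM P0); rewrite /symmetric_mx raddfB /= trmx1 R4.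
Qed.

Lemma G_id (v : 'cV_nu) : B *m v = 0 -> R *m v = 0 -> G *m v = v.
Proof.
move=> Bv Rv; rewrite mulmxBl mul1mx -mulmxA.
by rewrite mulmxDl -!mulmxA Bv Rv !mulmx0 addr0 mulmx0 subr0.
Qed.

Lemma G_idem : G *m G = G.
Proof.
by rewrite {1}/G mulmxBl mul1mx -mulmxA RM_G mulmx0 subr0.
Qed.

(** As [B *m G = 0], the product is the same for every matrix; at [L] it vanishes by the kernel
    inclusion that $H_L\succeq0$ entails. *)
Lemma SM_G P : (SM P)^T *m G = 0.
Proof.
have E M : (SM M)^T *m G = S^T *m G.
  rewrite [(SM M)^T]linearD /= mulmxDl !trmx_mul trmxK -!mulmxA B_G.
  by rewrite !mulmx0 addr0.
rewrite E -(E L); apply: mulmx_cV_inj => v; rewrite mul0mx -mulmxA.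
by apply: (HM_ker pL); rewrite mulmxA RM_G mul0mx.
Qed.

(** Multiplying $(R_P+G)v=0$ by $G$ gives $Gv=0$, hence $R_Pv=0$; but [G] fixes every vector of that
    kernel, so $v=Gv=0$. *)
Lemma RMG_unit P : cgdare A B Q S R P -> RM P + G \in unitmx.
Proof.
move=> cP; have [sP _ _] := cP.
have sRG : symmetric_mx (RM P + G).
  by apply: symmetric_mxD; [exact: sym_RM|exact: sym_G].
rewrite -unitmx_tr -row_free_unit; apply: inj_row_free => v v0.
have {v0} v0 : (RM P + G) *m v^T = 0.
  by apply: trmx_inj; rewrite trmx_mul trmxK v0 trmx0.
have GR : G *m RM P = 0.
  by apply: trmx_inj; rewrite trmx_mul sym_G (sym_RM sP) RM_G trmx0.
have Gv : G *m v^T = 0.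
  have := congr1 (mulmx G) v0.
  by rewrite mulmx0 mulmxA mulmxDr GR add0r G_idem.
have Rv : RM P *m v^T = 0 by move: v0; rewrite mulmxDl Gv addr0.
have [Bv Rv'] := cgdare_ker cP Rv.
by apply: trmx_inj; rewrite trmx0 -(G_id Bv Rv').
Qed.

(** [G] annihilates the range of $R_P^\dagger$, so the CGDARE gain already solves the regularized
    linear equation. *)
Lemma rdare_gainE P : symmetric_mx P -> RM P + G \in unitmx ->
  ker_sub (RM P) (SM P)^T -> rdare_gain A B S R G P = gain P.
Proof.
move=> sP uP kP; have sR := sym_RM sP.
have GR : G *m RM P = 0.
  by apply: trmx_inj; rewrite trmx_mul sym_G sR RM_G trmx0.
have [_ R2 _ R4] := pinvP (RM P).
have GK : G *m gain P = 0.
  rewrite /cgdare_gain -R2 -R4 trmx_mul sR !mulmxA GR.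
  by rewrite !mul0mx.
have RK : (RM P + G) *m gain P = SM P.
  by rewrite mulmxDl GK addr0 pinvKsub.
by rewrite /rdare_gain -[in LHS]RK mulKmx.
Qed.

Lemma rdare_cgdare P : rdare A B Q S R G P <-> cgdare A B Q S R P.
Proof.
split=> [[sP uP P_eq]|cP].
  have kP : ker_sub (RM P) (SM P)^T.
    move=> v Rv.
    (* The kernel condition is recovered from invertibility: $R_P+G$ sends both $v$ and $Gv$ to
       $Gv$, and $S_P^\top G=0$. *)
    have <- : G *m v = v.
      apply: (can_inj (mulKmx uP)); rewrite (mulmxDl (RM P) G v).
      by rewrite Rv (mulmxDl (RM P) G (G *m v)) !mulmxA RM_G G_idem mul0mx.
    by rewrite mulmxA SM_G mul0mx.
  by split=> //; rewrite -rdare_gainE.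
have [sP P_eq kP] := cP; have uP := RMG_unit cP.
by split=> //; rewrite rdare_gainE.
Qed.

Lemma rdare_stabilizingP P : rdare_stabilizing A B Q S R G P <->
  cgdare A B Q S R P /\ schur_stable (A - B *m gain P).
Proof.
split=> [[/[dup] rP /rdare_cgdare cP]|[cP]].
  by rewrite rdare_gainE //; case: cP => // sP _ kP; case: rP.
have [sP uP _] := (rdare_cgdare P).2 cP; have [_ _ kP] := cP.
by rewrite /rdare_stabilizing rdare_gainE // => st; split=> //; apply/rdare_cgdare.
Qed.

End Regularization.

(** * Lower bound, attainment and characterization of optimal pairs *)

Section Optimality.
Variables Ps Pb Pf : 'M[F]_nx.
Hypotheses (cPs : cgdare A B Q S R Ps) (pPs : possemidef (HM Ps)).
Hypothesis stPs : schur_stable (A - B *m gain Ps).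
Hypotheses (sPb : symmetric_mx Pb) (pPb : possemidef (HM Pb)).
Hypothesis dPf : posdef (Pf - Pb).

Local Notation horizon_cost := (horizon_cost Q S R Pf).
Local Notation feasible_cost := (feasible_cost A B Q S R Pf).

Lemma horizon_costE P x0 x u N : symmetric_mx P -> trajectory A B x0 x u ->
  horizon_cost x u N =
  qform P x0 + \sum_(0 <= k < N) hcost P (x k) (u k) + qform (Pf - P) (x N).
Proof. by move=> sP xt; rewrite (sum_HM N sP xt) qform_mxB /horizon_cost; ring. Qed.

Lemma sum_hcost_ge0 P x u N : possemidef (HM P) ->
  0 <= \sum_(0 <= k < N) hcost P (x k) (u k).
Proof. by move=> pP; apply: sumr_ge0 => k _; exact: hcost_ge0. Qed.

Lemma bounded_cost_vanish x0 x u C : trajectory A B x0 x u ->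
  (forall N, horizon_cost x u N <= C) ->
  exists2 e : nat -> F, e @ \oo --> 0 & forall k i, (x k i 0) ^+ 2 <= e k.
Proof.
move=> xt JC.
have [c c0 coord] := posdef_coord_bound dPf.
pose b := c * (C - qform Pb x0).
have xb N i : (x N i 0) ^+ 2 <= b.
  apply: (le_trans (coord _ _)); apply: ler_wpM2l => //.
  have := JC N; rewrite (horizon_costE N sPb xt).
  have := sum_hcost_ge0 x u N pPb; lra.
have [s Ws] : exists s, forall N, `|qform (Pf - L) (x N)| <= s.
  by eexists => N; apply: qform_bound; exact: xb.
have cvh : cvgn (series (fun k => hcost L (x k) (u k))).
  apply: nondecreasing_is_cvgn.
    apply/nondecreasing_seqP => k.
    by rewrite !seriesEnat /= big_nat_recr //= lerDl hcost_ge0.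
  exists (C - qform L x0 + s) => _ [N _ <-]; rewrite seriesEnat /=.
  have := JC N; rewrite (horizon_costE N sL xt).
  have := Ws N; rewrite ler_norml => /andP[]; lra.
have [d d0 coord'] := posdef_coord_bound dL.
exists (fun k => d * hcost L (x k) (u k)).
  rewrite -[X in _ --> X](mulr0 d); apply: cvgMr; exact: cvg_series_cvg_0.
move=> k i; apply: (le_trans (coord' _ _)); apply: ler_wpM2l => //.
exact: residual_le_hcost.
Qed.

(** The first [N] terms are kept for two uses: [N = 0] bounds the optimal value, and [N = k.+1]
    forces the terms of an optimal pair to vanish. *)
Lemma feasible_cost_ge x0 x u c N : feasible_cost x0 x u c ->
  ((qform Ps x0 + \sum_(0 <= k < N) hcost Ps (x k) (u k))%:E <= c)%E.
Proof.
move=> [xt Jc]; have [sPs _ _] := cPs.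
case: c Jc => [c| |] Jc; [|exact: leey|].
  have {}Jc : horizon_cost x u @ \oo --> c by exact: fine_cvg Jc.
  have [C JC] : exists C, forall M, horizon_cost x u M <= C.
    have [C HC] := cvg_has_ub (cvgP _ Jc); exists C => M.
    by apply: (le_trans (ler_norm _)); apply: HC; exists M.
  have [e e0 xe] := bounded_cost_vanish xt JC.
  have lim : (fun M => horizon_cost x u M - qform (Pf - Ps) (x M)) @ \oo --> c.
    rewrite -[X in _ --> X]subr0; apply: cvgB Jc _.
    exact: qform_vanish e0 xe.
  rewrite lee_fin; apply: (cvg_ge_eventually N lim) => M NM.
  rewrite (horizon_costE M sPs xt) addrK lerD2l (big_cat_nat (leq0n N) NM) //= lerDl.
  by apply: sumr_ge0 => k _; exact: hcost_ge0.
(* The limit $-\infty$ is excluded because every horizon cost is at least the form of [Pb] at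
   [x0]. *)
have : ((qform Pb x0)%:E <= -oo)%E; last by rewrite leeNy_eq.
apply: (cvge_to_ge Jc); near=> M; rewrite lee_fin (horizon_costE M sPb xt).
rewrite -addrA lerDl addr_ge0 ?sum_hcost_ge0 //.
have [->|/dPf.2/ltW//] := eqVneq (x M) 0; first by rewrite qform0.
Unshelve. all: by end_near.
Qed.

(** The deviation from the feedback lies in $\ker R_{P_s}\subseteq\ker B$, so it leaves the state
    unaffected. *)
Lemma trajectory_closed_loop x0 x u : trajectory A B x0 x u ->
  (forall k, RM Ps *m (u k + gain Ps *m x k) = 0) ->
  forall k, x k = (A - B *m gain Ps) ^+ k *m x0.
Proof.
move=> [<- xS] R0; elim=> [|k IH]; first by rewrite expr0 mul1mx.
have [Bu _] := cgdare_ker cPs (R0 k).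
rewrite exprS -mulmxE -mulmxA -IH xS mulmxBl -mulmxA.
by move: Bu; rewrite mulmxDr => /eqP; rewrite addr_eq0 => /eqP ->.
Qed.

Lemma closed_loop_cost x0 x u : trajectory A B x0 x u ->
  (forall k, RM Ps *m (u k + gain Ps *m x k) = 0) ->
  feasible_cost x0 x u (qform Ps x0)%:E.
Proof.
move=> xt R0; split=> //; have [sPs _ _] := cPs.
have xk := trajectory_closed_loop xt R0.
have [e e0 xe] := schur_stable_vanish x0 stPs.
have xe' k i : (x k i 0) ^+ 2 <= e k by rewrite xk.
apply: cvg_EFin; first by near=> k.
have -> : fine \o (fun N => (horizon_cost x u N)%:E) =
    (fun N => qform Ps x0 + qform (Pf - Ps) (x N)).
  apply/funext => N /=; rewrite (horizon_costE N sPs xt) big1 ?addr0 // => k _.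
  by rewrite cgdare_HM // /qform -mulmxA R0 mulmx0 mxE.
rewrite -[X in _ --> X]addr0; apply: cvgD; first exact: cvg_cst.
exact: qform_vanish e0 xe'.
Unshelve. all: by end_near.
Qed.

Lemma optimal_value x0 : is_optimal_value A B Q S R Pf x0 (qform Ps x0)%:E.
Proof.
split=> [|x u c /(feasible_cost_ge 0)]; last by rewrite big_geq // addr0.
pose x k := (A - B *m gain Ps) ^+ k *m x0.
exists x, (fun k => - (gain Ps *m x k)); apply: closed_loop_cost.
  split=> [|k]; first by rewrite /x expr0 mul1mx.
  by rewrite closed_loopE /x exprS -mulmxE -mulmxA.
by move=> k; rewrite addNr mulmx0.
Qed.

Lemma is_optimalP x0 x u : is_optimal A B Q S R Pf x0 x u <->
  trajectory A B x0 x u /\ forall k, RM Ps *m (u k + gain Ps *m x k) = 0.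
Proof.
split=> [[V [[x' [u' xV']] minV] xV]|[xt R0]]; last first.
  exists (qform Ps x0)%:E; first exact: optimal_value.
  exact: closed_loop_cost.
split=> [|k]; first by case: xV.
have [[x1 [u1 x1V]] _] := optimal_value x0.
have := le_trans (feasible_cost_ge k.+1 xV) (minV _ _ _ x1V).
rewrite lee_fin gerDl big_nat_recr //= => h.
have [sPs _ _] := cPs.
apply: psd_ker; first by split=> [|v]; [exact: sym_RM|exact: RM_ge0].
rewrite -cgdare_HM //; apply/le_anti; rewrite hcost_ge0 // andbT.
by apply: le_trans h; rewrite lerDr sum_hcost_ge0.
Qed.

Lemma optimally_controlledE x : optimally_controlled A B Q S R Pf x <->
  forall k, x k = (A - B *m gain Ps) ^+ k *m x 0%N.
Proof.
split=> [[u /is_optimalP[xt R0]]|xk]; first exact: trajectory_closed_loop xt R0.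
exists (fun k => - (gain Ps *m x k)); apply/is_optimalP; split=> [|k].
  split=> // k; rewrite closed_loopE [x k.+1]xk [in RHS]xk exprS.
  by rewrite -mulmxE -mulmxA.
by rewrite addNr mulmx0.
Qed.

Lemma optimally_controlled_stable :
  asymptotically_stable_origin (optimally_controlled A B Q S R Pf).
Proof.
have [r [c [/andP[r0 r1] c0 Mk]]] := schur_stable_iter stPs.
have xb x : optimally_controlled A B Q S R Pf x ->
    forall k, `|x k| <= c * r ^+ k * `|x 0%N|.
  move=> /optimally_controlledE xk k; rewrite [leLHS]mx_normrE.
  apply: bigmax_le => [|[i j] _]; first by rewrite !mulr_ge0 // exprn_ge0.
  by rewrite ord1 /= xk; apply: Mk => l; exact: cV_coord_bound.
split.
- split=> [|x /optimally_controlledE xk x0 k]; last by rewrite xk x0 mulmx0.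
  by apply/optimally_controlledE => k; rewrite mulmx0.
(* The constant [c] may be 0, hence [c + 1]. *)
- move=> e e0; exists (e / (c + 1)); first by rewrite divr_gt0 // ltr_wpDl.
  move=> x /xb xk x0 k; apply: (le_lt_trans (xk k)).
  have rk : r ^+ k <= 1 by rewrite exprn_ile1 // ltW.
  apply: (@le_lt_trans _ _ ((c + 1) * `|x 0%N|)).
    apply: ler_wpM2r => //; apply: (@le_trans _ _ (c * 1)).
      exact: ler_wpM2l.
    by rewrite mulr1 lerDl.
  by rewrite mulrC -ltr_pdivlMr // ltr_wpDl.
(* Attraction is global, so the radius 1 is arbitrary. *)
- exists 1 => // x /xb xk _; apply/norm_cvg0P.
  have lim : (fun k => c * `|x 0%N| * r ^+ k) @ \oo --> (0 : F).
    by apply: geometric_cvg0; rewrite r0.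
  apply: (squeeze_cvgr _ (cvg_cst 0) lim); near=> k.
  by rewrite normr_ge0 /= mulrAC; exact: xk.
Unshelve. all: by end_near.
Qed.

End Optimality.
End Predissipative.
End Riccati.

(** * Time reversal and the sign of $H$ at $\bar P_s$ *)

Section ReverseTime.
Variables (F : realType) (nx nu : nat).
Variables (A : 'M[F]_nx) (B : 'M[F]_(nx, nu)).
Variables (Q : 'M[F]_nx) (S : 'M[F]_(nu, nx)) (R : 'M[F]_nu).
Hypotheses (uA : A \in unitmx) (sym_cost : symmetric_mx (cost_mx Q S R)).

Local Notation Ab := (revA A).
Local Notation Bb := (revB A B).
Local Notation Qb := (revQ A Q).
Local Notation Sb := (revS A B Q S).
Local Notation Rb := (revR A B Q S R).

Lemma sym_rev_cost : symmetric_mx (cost_mx Qb Sb Rb).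
Proof.
have sQ := sym_Q sym_cost; have sR := sym_R sym_cost.
rewrite /symmetric_mx tr_block_mx trmxK; congr block_mx.
  by rewrite /revQ linearN /= !trmx_mul trmxK sQ mulmxA.
have E : (Bb^T *m Q *m Bb)^T = Bb^T *m Q *m Bb by exact: symmetric_congr.
rewrite /revR !(linearD, linearN) /= E [(S *m Bb)^T]trmx_mul.
by rewrite [(Bb^T *m S^T)^T]trmx_mul !trmxK sR; congr (_ - _); exact: addrAC.
Qed.

(* In reverse time the successor y = A x + B u is the state and w = -u the
   input, and the stage cost changes sign. *)
Lemma rev_cost y w :
  qform (cost_mx Qb Sb Rb) (col_mx y w) =
  - qform (cost_mx Q S R) (col_mx (Ab *m y + Bb *m w) (- w)).
Proof.
have sQ := sym_Q sym_cost.
have E1 : qform Qb y = - qform Q (Ab *m y).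
  by rewrite qformE bform_mxN bform_congr.
have E2 : bform Sb w y = bform S w (Ab *m y) - bform Q (Bb *m w) (Ab *m y).
  by rewrite bform_mxD bform_mxN bform_congr bform_mulr.
have E3 : qform Rb w =
    - qform R w + bform S w (Bb *m w) *+ 2 - qform Q (Bb *m w).
  rewrite qformE !bform_mxD !bform_mxN bform_congr bform_mulr bform_mull.
  by rewrite bform_tr -!qformE; ring.
rewrite !bform_transpose_block E1 E2 E3 qformD // qformN.
by rewrite bformNl bformDr (bform_symC _ _ sQ); ring.
Qed.

Lemma rcgdare_cgdare P : rcgdare A B Q S R P -> cgdare Ab Bb Qb Sb Rb P.
Proof.
move=> [sP eP kP].
have E : (SM Ab Bb Sb P)^T = Sb^T + Ab^T *m P *m Bb.
  by rewrite [LHS]linearD /= 2!trmx_mul trmxK sP mulmxA.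
split=> //; last by rewrite E.
rewrite E /QM [RHS]addrAC; move/eqP: eP; rewrite -subr_eq0 => /eqP.
by rewrite -opprB => /eqP; rewrite oppr_eq0 => /eqP ->.
Qed.

(** Completing the square in reverse time writes $-H_{\bar P}$ as a form in the reversed input
    weight [Rt], so it suffices that [Rt] is negative semidefinite. Along the reverse closed loop
    the form of [Pb - L] does not decrease and tends to 0, whence $\bar P\preceq L$, and this bounds
    [Rt]. *)
Lemma rcgdare_stabilizing_psd L Pb :
  symmetric_mx L -> possemidef (HM A B Q S R L) ->
  rcgdare_stabilizing A B Q S R Pb -> possemidef (HM A B Q S R Pb).
Proof.
move=> sL pL [/[dup] rPb /rcgdare_cgdare cPb st].
have sPb : symmetric_mx Pb by case: cPb.
pose Rt := RM Bb Rb Pb; pose K := cgdare_gain Ab Bb Sb Rb Pb.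
have revE (x : 'cV_nx) (u : 'cV_nu) :
    let y := A *m x + B *m u in x = Ab *m y + Bb *m - u.
  by rewrite /= /revA /revB mulmxDr mulKmx // mulmxN !mulmxA addrK.
have sqr (x : 'cV_nx) (u : 'cV_nu) : qform Rt (- u + K *m (A *m x + B *m u)) =
    - qform (HM A B Q S R Pb) (col_mx x u).
  rewrite -(cgdare_HM sym_rev_cost) // HM_qform //.
  rewrite rev_cost -revE opprK HM_qform //; ring.
have dec y : qform (Pb - L) y <= qform (Pb - L) ((Ab - Bb *m K) *m y).
  pose u := K *m y; pose x := Ab *m y + Bb *m - u.
  have xy : A *m x + B *m u = y.
    rewrite /x /revA /revB mulmxDr mulKVmx // mulmxN -mulmxA mulmxN mulKVmx //.
    exact: subrK.
  have := sqr x u; rewrite xy addNr qform0 => /eqP.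
  rewrite eq_sym oppr_eq0 => /eqP H0.
  have := HM_sub A B Q S R x u sPb sL.
  rewrite H0 xy sub0r /x closed_loopE.
  have := hcost_ge0 x u pL; rewrite /x closed_loopE; lra.
have PbL y : qform (Pb - L) y <= 0.
  have [e e0 xe] := schur_stable_vanish y st.
  apply: (cvg_ge_eventually 0 (qform_vanish (Pb - L) e0 xe)) => k _.
  elim: k => [|k IH]; first by rewrite expr0 mul1mx.
  by apply: (le_trans IH); rewrite exprS -mulmxE -mulmxA; exact: dec.
(* The pair [Bb *m w], [- w] has successor 0, so the feedback term drops out and the reversed square
   is [Rt] at [w] alone. *)
have Rt0 w : qform Rt w <= 0.
  have xy : A *m (Bb *m w) + B *m - w = 0.
    by rewrite /revB -mulmxA mulKVmx // mulmxN subrr.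
  have := sqr (Bb *m w) (- w); rewrite xy mulmx0 addr0 opprK => ->.
  have := HM_sub A B Q S R (Bb *m w) (- w) sPb sL; rewrite xy qform0.
  have := PbL (Bb *m w); have := hcost_ge0 (Bb *m w) (- w) pL; lra.
apply: possemidef_HM => // x u.
by rewrite -oppr_le0 -sqr.
Qed.

End ReverseTime.

Theorem theorem5p1 (F : realType) (nx nu : nat)
    (A : 'M[F]_nx) (B : 'M[F]_(nx, nu))
    (Q : 'M[F]_nx) (S : 'M[F]_(nu, nx)) (R : 'M[F]_nu)
    (Pf Pbar : 'M[F]_nx)
    (hA : A \in unitmx)
    (hctrl : controllable A B)
    (hH : symmetric_mx (cost_mx Q S R))
    (hdiss : strictly_predissipative A B Q S R)
    (hPbar : rcgdare_stabilizing A B Q S R Pbar)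
    (hPf : symmetric_mx Pf)
    (hPfPbar : posdef (Pf - Pbar)) :
  (exists P, cgdare A B Q S R P) /\
  forall P, cgdare A B Q S R P ->
    let G := Gmx B R P in
    exists Ps, let Ks := rdare_gain A B S R G Ps in
      [/\ unique (rdare_stabilizing A B Q S R G) Ps,
          forall x0, is_optimal_value A B Q S R Pf x0 (qform Ps x0)%:E,
          forall x0 x u, is_optimal A B Q S R Pf x0 x u <->
            trajectory A B x0 x u /\
            exists v : nat -> 'cV[F]_nu,
              forall k, u k = - (Ks *m x k) + G *m v k
        & asymptotically_stable_origin
            (optimally_controlled A B Q S R Pf)].
Proof.
have [L [sL pL dL0]] := hdiss.
have dL : posdef (riccati_residual A B Q S R L).
  by rewrite /riccati_residual /cgdare_gain mulmxA.
have [Ps [cPs pPs _ st]] := cgdare_exists hH sL pL dL hctrl.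
have [sPs _ kPs] := cPs.
have sPb : symmetric_mx Pbar by case: hPbar => - [].
have pPb := rcgdare_stabilizing_psd hA hH sL pL hPbar.
split=> [|P cP G]; first by exists Ps.
have uG := RMG_unit hH sL pL dL cP cPs.
have KE := rdare_gainE hH sL pL dL cP sPs uG kPs.
have stP := rdare_stabilizingP hH sL pL dL cP.
have optP := is_optimalP hH sL pL dL cPs pPs st sPb pPb hPfPbar.
exists Ps => Ks; split.
- split=> [|P' /stP[cP' st']]; first by apply/stP; exact: (conj cPs st).
  exact: (stabilizing_uniq hH sL pL cPs st cP' st').
- exact: (optimal_value hH sL pL dL cPs pPs st sPb pPb hPfPbar).
- move=> x0 x u; rewrite optP /Ks KE; split=> - [xt H]; split=> //.
    (* The whole deviation from the feedback serves as [v], since [G] fixes $\ker B\cap\ker R$. *)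
    exists (fun k => u k + cgdare_gain A B S R Ps *m x k) => k.
    have [Bu Ru] := cgdare_ker hH sL pL dL cPs (H k).
    by rewrite G_id // addrC addrK.
  have [v uv] := H => k.
  by rewrite uv addrAC addNr add0r mulmxA (RM_G hH sL pL dL cP) mul0mx.
- exact: (optimally_controlled_stable hH sL pL dL cPs pPs st sPb pPb hPfPbar).
Qed.
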